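(* Let $\mathcal F$ be a filtration array and $E=(E_{m,n})_{m,n\in\mathbb N}$ a nonnegative process adapted to $\mathcal F$ having the asymptotic supermartingale property (in $L_1$, for $\mathcal F$, uniformly in $\mathcal P$). If $E$ is asymptotically calibrated, i.e. $\limsup_{m\to\infty}\sup_{P\in\mathcal P}\mathbb E_P[E_{m,0}]\le 1$, then $E$ is an $r$-asymptotic e-process for $\mathcal P$ and $\mathcal F$ for every extended integer sequence $r=(r_m)_{m\in\mathbb N}$ satisfying $$\lim_{m\to\infty}\sup_{P\in\mathcal P}\mathbb E_P\Big[\sum_{n=0}^{r_m-1}\delta_{m,n}^+\Big]=0 .$$
   Context: $(\Omega,\mathcal A)$ is a measurable space, $\mathcal P$ a set of probability measures on it, $\mathbb N=\{0,1,\dots\}$; extended integers are elements of $\mathbb N\cup\{\infty\}$. Nonnegative random variables take values in $[0,\infty]$ with $\mathbb E_P[X]:=\infty$ if not $P$-integrable; $X_\infty:=\limsup_nX_n$. A filtration array is a family $(\mathcal F_{m,n})_{m,n\in\mathbb N}$ of sub-$\sigma$-algebras with $\mathcal F_{m,n}\subset\mathcal F_{m+1,n}\cap\mathcal F_{m,n+1}$; adapted means $E_{m,n}$ is $\mathcal F_{m,n}$-measurable. For $P\in\mathcal P$, $\delta_{m,n}=\mathbb E_P[E_{m,n+1}\mid\mathcal F_{m,n}]-E_{m,n}$ if $E_{m,n+1}$ is $P$-integrable and $\delta_{m,n}=\infty$ otherwise (dependence on $P$ suppressed); $x^+=\max\{x,0\}$. The asymptotic supermartingale property: $\lim_{m}\sup_{P\in\mathcal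 P}\mathbb E_P[\delta_{m,n}^+]=0$ for every $n$. For a filtration $\mathcal G$ and $\rho\in\mathbb N\cup\{\infty\}$, $\mathcal T(\rho,\mathcal G,\mathcal P)$ is the set of $\mathcal G$-stopping times $\tau$ (values in $\mathbb N\cup\{\infty\}$) with $P[\tau\le\rho]=1$ for all $P\in\mathcal P$; $\mathcal T(r,\mathcal F,\mathcal P)$ is the set of sequences $(\tau_m)$ with $\tau_m\in\mathcal T(r_m,\mathcal F_{m,\bullet},\mathcal P)$. $E$ is an $r$-asymptotic e-process if for every $\tau\in\mathcal T(r,\mathcal F,\mathcal P)$, $\limsup_m\sup_{P\in\mathcal P}\mathbb E_P[E_{m,\tau_m}]\le 1$. *)

(* Defs.v *)
From HB Require Import structures.
From mathcomp Require Import all_boot all_order all_algebra.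
From mathcomp Require Import all_classical all_reals all_analysis.
From mathcomp Require Import measurable_realfun.
Set Implicit Arguments. Unset Strict Implicit. Unset Printing Implicit Defensive.
Import Order.TTheory GRing.Theory Num.Theory.
Local Open Scope classical_set_scope.
Local Open Scope ring_scope.
Local Open Scope ereal_scope.

Section Defs.
Context {d : measure_display} {T : measurableType d} {R : realType}.

(* Extended integers N u {oo}: None stands for oo. *)
Definition enat_le (a b : option nat) : bool :=
  match b with
  | None => true
  | Some b' => match a with None => false | Some a' => (a' <= b')%N end
  end.

Definition sub_sigma (G : set (set T)) : Prop :=
  sigma_algebra setT G /\ G `<=` measurable.

Definition Gmeasurable (G : set (set T)) (f : T -> \bar R) : Prop :=
  forall B : set (\bar R), measurable B -> G (f @^-1` B).

Definition filtration_array (F : nat -> nat -> set (set T)) : Prop :=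
  (forall m n, sub_sigma (F m n)) /\
  (forall m n, F m n `<=` F m.+1 n `&` F m n.+1).

Definition adapted (F : nat -> nat -> set (set T)) (E : nat -> nat -> T -> \bar R) :=
  forall m n, Gmeasurable (F m n) (E m n).

Definition is_cond_exp (P : probability T R) (G : set (set T))
    (X Y : T -> \bar R) : Prop :=
  Gmeasurable G Y /\ P.-integrable setT Y /\
  forall A, G A -> \int[P]_(x in A) Y x = \int[P]_(x in A) X x.

(* delta_{m,n} for P, computed with the chosen versions C P m n of
   E_P[E_{m,n+1} | F_{m,n}] *)
Definition delta (E : nat -> nat -> T -> \bar R)
    (C : probability T R -> nat -> nat -> T -> \bar R)
    (P : probability T R) (m n : nat) (x : T) : \bar R :=
  if `[< P.-integrable setT (E m n.+1) >] then C P m n x - E m n x else +oo.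

Definition posp (v : \bar R) : \bar R := maxe v 0.

(* supremum over P in Pset, taken in [0, oo] *)
Definition supP (Pset : set (probability T R)) (f : probability T R -> \bar R)
  : \bar R := ereal_sup ([set 0] `|` [set f P | P in Pset]).

Definition stopping_time (G : nat -> set (set T)) (tau : T -> option nat) : Prop :=
  forall n, G n [set x | enat_le (tau x) (Some n)].

Definition stopping_times_bdd (rho : option nat) (G : nat -> set (set T))
    (Pset : set (probability T R)) (tau : T -> option nat) : Prop :=
  stopping_time G tau /\
  forall P, Pset P -> P [set x | enat_le (tau x) rho] = 1.

Definition stopped (E : nat -> nat -> T -> \bar R) (m : nat)
    (tau : T -> option nat) (x : T) : \bar R :=
  match tau x with
  | Some n => E m n x
  | None => limn_esup (fun n => E m n x)
  end.

Definition esum_upto (k : option nat) (f : nat -> \bar R) : \bar R :=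
  match k with
  | Some k' => \sum_(0 <= n < k') f n
  | None => \sum_(0 <= n <oo) f n
  end.

End Defs.

(* Main.v *)
(** Fix [m] and [P].  The conditional-expectation property gives, for [A] in
    [F m n], [\int_A E_(n+1) <= \int_A E_n + \int delta_n^+]; this passes to the
    stopped process [Y_n = E_(min tau n)].  A nonnegative process whose integrals
    over past events increase by at most a summable sequence of constants
    satisfies Doob's upcrossing bound, so [limsup Y = liminf Y] almost surely and
    Fatou's lemma yields
    [\int E_tau <= \int E_0 + \int sum_(n < r) delta_n^+].
    It remains to take suprema over [P] and let [m] tend to infinity. *)

Require Import Defs.
From HB Require Import structures.
From mathcomp Require Import all_boot all_order all_algebra.
From mathcomp Require Import all_classical all_reals all_analysis.
From mathcomp Require Import measurable_realfun.
Set Implicit Arguments.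
Unset Strict Implicit.
Unset Printing Implicit Defensive.

Import Order.TTheory GRing.Theory Num.Theory.
Local Open Scope classical_set_scope.
Local Open Scope ring_scope.
Local Open Scope ereal_scope.

(** * Limits superior and inferior of extended real sequences *)

Section LimnEsup.
Context {R : realType}.
Implicit Types (u v w : (\bar R)^nat) (l : \bar R).

Lemma limn_esup_le_near u l :
  (\forall n \near \oo, u n <= l) -> limn_esup u <= l.
Proof.
move=> ul; apply: ge_ereal_inf.
exists (ereal_sup (u @` [set n | u n <= l])); first by exists [set n | u n <= l].
by apply: ge_ereal_sup => _ [n /= uln <-].
Qed.

Lemma le_limn_einf_near u l :
  (\forall n \near \oo, l <= u n) -> l <= limn_einf u.
Proof.
move=> lu; rewrite /limn_einf leeNr; apply: limn_esup_le_near.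
by apply: filterS lu => n lun; rewrite leeNr oppeK.
Qed.

Lemma limn_esup_lt_near u l :
  limn_esup u < l -> \forall n \near \oo, u n < l.
Proof.
move=> /ereal_inf_lt[_ [V Voo <-] supVl].
apply: filterS Voo => n Vn; apply: le_lt_trans supVl.
by apply: ereal_sup_ubound; exists n.
Qed.

(** Since the bound [r] is finite, a slack [e] can be added to it and shared equally between [v] and
    [w]. *)
Lemma limn_esup_le_add_cvg0 u v w (r : R) :
  (forall n, u n <= v n + w n) -> limn_esup v <= r%:E -> w @ \oo --> 0 ->
  limn_esup u <= r%:E.
Proof.
move=> uvw vr w0; apply/lee_addgt0Pr => e e0.
apply: limn_esup_le_near.
have e20 : (0 < e / 2)%R by rewrite divr_gt0.
have vlt : \forall n \near \oo, v n < (r + e / 2)%:E.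
  by apply: limn_esup_lt_near; apply: le_lt_trans vr _; rewrite lte_fin ltrDl.
have wlt : \forall n \near \oo, w n < (e / 2)%:E.
  by apply: limn_esup_lt_near; rewrite (cvg_limn_einf_sup w0).2 lte_fin.
near=> n; apply: (le_trans (uvw n)).
rewrite -EFinD [e in leRHS]splitr addrA EFinD; apply: leeD; apply: ltW.
- by near: n.
- by near: n.
Unshelve. all: by end_near.
Qed.

End LimnEsup.

(** * Events and functions measurable for a sub-sigma-algebra *)

Section SubSigma.
Context {d : measure_display} {T : measurableType d} {R : realType}.
Variable G : set (set T).
Hypothesis sG : sub_sigma G.

Lemma sub_sigma_measurable A : G A -> measurable A.
Proof. exact: sG.2. Qed.

Lemma sub_sigmaC A : G A -> G (~` A).
Proof. by case: sG => -[_ GD _] _ /GD; rewrite setTD. Qed.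

Lemma sub_sigmaT : G setT.
Proof. by rewrite -setC0; apply: sub_sigmaC; case: sG => -[]. Qed.

Lemma sub_sigmaU A B : G A -> G B -> G (A `|` B).
Proof.
case: sG => -[G0 _ GU] _ GA GB; rewrite -bigcup2E; apply: GU => n.
by rewrite /bigcup2; case: ifP => // _; case: ifP.
Qed.

Lemma sub_sigmaI A B : G A -> G B -> G (A `&` B).
Proof.
move=> GA GB; rewrite -[A]setCK -[B]setCK -setCU.
by apply: sub_sigmaC; apply: sub_sigmaU; apply: sub_sigmaC.
Qed.

Lemma Gmeasurable_measurable_fun (f : T -> \bar R) :
  Gmeasurable G f -> measurable_fun setT f.
Proof. by move=> Gf _ B mB; rewrite setTI; apply/sub_sigma_measurable/Gf. Qed.

Lemma Gmeasurable_if (h : T -> bool) (f g : T -> \bar R) :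
  G [set x | h x] -> Gmeasurable G f -> Gmeasurable G g ->
  Gmeasurable G (fun x => if h x then f x else g x).
Proof.
move=> Gh Gf Gg B mB.
rewrite (_ : _ @^-1` B = ([set x | h x] `&` f @^-1` B) `|`
                         (~` [set x | h x] `&` g @^-1` B)); last first.
  apply/seteqP; split=> x /=.
    by case: (h x) => Bx; [left|right].
  by case: (h x) => -[] [].
by apply: sub_sigmaU; apply: sub_sigmaI => //;
  [exact: Gf|exact: sub_sigmaC|exact: Gg].
Qed.

Lemma Gmeasurable_lt (f : T -> \bar R) (a : \bar R) :
  Gmeasurable G f -> G [set x | f x < a].
Proof.
move=> /(_ [set` `]-oo, a[ ])/(_ (emeasurable_itv _)).
by congr G; apply/seteqP; split=> x /=; rewrite in_itv.
Qed.

Lemma Gmeasurable_le (f : T -> \bar R) (a : \bar R) :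
  Gmeasurable G f -> G [set x | f x <= a].
Proof.
move=> /(_ [set` `]-oo, a] ])/(_ (emeasurable_itv _)).
by congr G; apply/seteqP; split=> x /=; rewrite in_itv.
Qed.

End SubSigma.

Lemma measurable_fun_set_bool {d : measure_display} {T : measurableType d}
  (h : T -> bool) : measurable [set x | h x] -> measurable_fun setT h.
Proof. by move=> mh; apply: (measurable_fun_bool true); rewrite setTI. Qed.

Lemma ge0_integral_setIC {d : measure_display} {T : measurableType d}
    {R : realType} (mu : measure T R) (A B : set T) (f : T -> \bar R) :
  measurable A -> measurable B -> measurable_fun setT f -> (forall x, 0 <= f x) ->
  \int[mu]_(x in A) f x =
    \int[mu]_(x in A `&` B) f x + \int[mu]_(x in A `&` ~` B) f x.
Proof.
move=> mA mB mf f0; rewrite -ge0_integral_setU//.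
- by rewrite -setIUr setUCr setIT.
- exact: measurableI.
- by apply: measurableI => //; exact: measurableC.
- exact: measurable_funTS.
- by apply/disj_set2P; rewrite setIACA setICr setI0.
Qed.

Lemma integral_probability_cst {d : measure_display} {T : measurableType d}
    {R : realType} (P : probability T R) (r : \bar R) : \int[P]_x r = r.
Proof.
rewrite integral_cst// -[RHS]mule1; congr (_ * _); exact: probability_setT.
Qed.

(** * Nonnegative processes with controlled upward drift *)

Section NearSupermartingale.
Context {d : measure_display} {T : measurableType d} {R : realType}.
Variables (P : probability T R) (F : nat -> set (set T)).
Hypothesis sF : forall n, sub_sigma (F n).
Hypothesis leF : forall n, F n `<=` F n.+1.

(** The drift is expressed by integrals over past events instead of conditional expectations, so
    that [X n] may fail to be integrable. *)
Definition near_supermartingale (X : nat -> T -> \bar R) (c : nat -> \bar R) :=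
  [/\ forall n, Gmeasurable (F n) (X n), forall n x, 0 <= X n x &
      forall n A, F n A ->
        \int[P]_(x in A) X n.+1 x <= \int[P]_(x in A) X n x + c n].

Section Theory.
Variables (X : nat -> T -> \bar R) (c : nat -> \bar R).
Hypothesis XP : near_supermartingale X c.
Hypothesis c0 : forall n, 0 <= c n.

Let GX n : Gmeasurable (F n) (X n). Proof. by case: XP. Qed.
Let X0 n x : 0 <= X n x. Proof. by case: XP. Qed.
Let mX n : measurable_fun setT (X n).
Proof. exact: (Gmeasurable_measurable_fun (sF n)). Qed.

Lemma near_supermartingale_integral_le n :
  \int[P]_x X n x <= \int[P]_x X 0%N x + \sum_(0 <= i < n) c i.
Proof.
elim: n => [|n IH]; first by rewrite big_geq// adde0.
rewrite big_nat_recr//= addeA.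
case: XP => _ _ /(_ n setT (sub_sigmaT (sF n))) /le_trans; apply.
by rewrite leeD2r.
Qed.

(* The strategy that buys below [a] and sells above [b]: [upcross_hold n] says
   whether a unit is held after trading at time [n]. *)
Fixpoint upcross_hold (a b : R) (n : nat) (x : T) : bool :=
  if n is k.+1 then
    if upcross_hold a b k x then X n x <= b%:E else X n x < a%:E
  else false.

(** Each sale withdraws [b - a] and leaves cash [a]; proceeds above [b] are discarded. *)
Definition upcross_gain (a b : R) (n : nat) (x : T) : \bar R :=
  if upcross_hold a b n x && (b%:E < X n.+1 x) then (b - a)%:E else 0.

(** Wealth left after withdrawals: the unit if held, otherwise the cash [a], enough for the next
    purchase. *)
Definition upcross_value (a b : R) (n : nat) (x : T) : \bar R :=
  if upcross_hold a b n x then X n x else a%:E.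

(** * Doob's upcrossing argument *)

Section Upcrossing.
Variables a b : R.
Hypotheses (a0 : (0 <= a)%R) (ab : (a < b)%R).

Lemma upcross_hold_F n : F n [set x | upcross_hold a b n x].
Proof.
elim: n => [|n IH] /=.
  rewrite (_ : [set _ | _] = set0); first by case: (sF 0%N) => -[].
  by apply/seteqP; split.
rewrite (_ : [set _ | _] =
    ([set x | upcross_hold a b n x] `&` [set x | X n.+1 x <= b%:E]) `|`
    (~` [set x | upcross_hold a b n x] `&` [set x | X n.+1 x < a%:E])); last first.
  apply/seteqP; split=> x /=.
    by case: (upcross_hold a b n x) => Xx; [left|right].
  by case: (upcross_hold a b n x) => -[] [].
apply: sub_sigmaU => //; apply: sub_sigmaI => //.
- exact/leF.
- exact: Gmeasurable_le.
- by apply: sub_sigmaC => //; exact/leF.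
- exact: Gmeasurable_lt.
Qed.

Let mhold n : measurable [set x | upcross_hold a b n x].
Proof. exact: (sub_sigma_measurable (sF n) (upcross_hold_F n)). Qed.

Lemma measurable_upcross_value n : measurable_fun setT (upcross_value a b n).
Proof.
by apply: measurable_fun_ifT => //; exact: measurable_fun_set_bool.
Qed.

Lemma measurable_upcross_gain n : measurable_fun setT (upcross_gain a b n).
Proof.
apply: measurable_fun_ifT => //.
apply: measurable_fun_set_bool.
rewrite (_ : [set _ | _] = [set x | upcross_hold a b n x] `&`
                           ~` [set x | X n.+1 x <= b%:E]); last first.
  apply/seteqP; split=> x /=.
    by move=> /andP[-> Xb]; split=> //; rewrite leNgt Xb.
  by move=> [-> /negP]; rewrite -ltNge.
apply: measurableI => //; apply: measurableC.
exact: (sub_sigma_measurable (sF n.+1) (Gmeasurable_le _ _)).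
Qed.

Lemma upcross_value_ge0 n x : 0 <= upcross_value a b n x.
Proof. by rewrite /upcross_value; case: ifP. Qed.

Lemma upcross_gain_ge0 n x : 0 <= upcross_gain a b n x.
Proof. by rewrite /upcross_gain; case: ifP => // _; rewrite lee_fin subr_ge0 ltW. Qed.

(** A purchase exchanges cash [a] for a unit worth less; a sale splits a unit worth more than [b]
    into [a] and [b - a]. *)
Lemma upcross_value_step n x :
  upcross_value a b n.+1 x + upcross_gain a b n x <=
  if upcross_hold a b n x then X n.+1 x else a%:E.
Proof.
rewrite /upcross_value /upcross_gain /=.
case: (upcross_hold a b n x) => /=; last first.
  by rewrite adde0; case: ltP => // /ltW.
by case: leP => [|/ltW]; rewrite ?adde0// -EFinD addrC subrK.
Qed.

(** The position held over the step is decided at time [n], so the drift inequality applies on [H];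
    off [H] the position is the constant [a]. *)
Lemma integral_upcross_step n :
  \int[P]_x upcross_value a b n.+1 x + \int[P]_x upcross_gain a b n x <=
  \int[P]_x upcross_value a b n x + c n.
Proof.
pose H := [set x | upcross_hold a b n x].
have HT : setT `&` H = H by rewrite setTI.
have HCT : setT `&` ~` H = ~` H by rewrite setTI.
rewrite -ge0_integralD//; last 4 first.
- by move=> x _; exact: upcross_value_ge0.
- exact: measurable_upcross_value.
- by move=> x _; exact: upcross_gain_ge0.
- exact: measurable_upcross_gain.
have mY : measurable_fun setT
    (fun x => if upcross_hold a b n x then X n.+1 x else a%:E).
  by apply: measurable_fun_ifT => //; exact: measurable_fun_set_bool.
apply: (@le_trans _ _
  (\int[P]_x (if upcross_hold a b n x then X n.+1 x else a%:E))).
  apply: ge0_le_integral => //.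
  - move=> x _; apply: adde_ge0.
      exact: upcross_value_ge0.
    exact: upcross_gain_ge0.
  - apply: emeasurable_funD.
      exact: measurable_upcross_value.
    exact: measurable_upcross_gain.
  - by move=> x _; exact: upcross_value_step.
rewrite (ge0_integral_setIC _ measurableT (mhold n))//; last by move=> x; case: ifP.
rewrite (ge0_integral_setIC _ measurableT (mhold n) (measurable_upcross_value n)
  (upcross_value_ge0 n)).
rewrite -/H !HT !HCT addeAC; apply: leeD.
  rewrite (eq_integral (X n.+1)); last by move=> x; rewrite inE /H/= => ->.
  rewrite [X in _ <= X + _](eq_integral (X n)); last first.
    by move=> x; rewrite inE /H/= /upcross_value => ->.
  by case: XP => _ _ /(_ n H (upcross_hold_F n)).
rewrite (eq_integral (upcross_value a b n))//.
by move=> x; rewrite inE /H/= /upcross_value => /negP/negbTE ->.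
Qed.

(** Doob's upcrossing inequality, telescoped. Nothing is held at time [0], hence the initial wealth
    [a]. *)
Lemma upcross_gain_sum_le n :
  \int[P]_x upcross_value a b n x + \sum_(0 <= i < n) \int[P]_x upcross_gain a b i x
  <= a%:E + \sum_(0 <= i < n) c i.
Proof.
elim: n => [|n IH].
  rewrite !big_geq// !adde0 /upcross_value /=.
  by rewrite integral_probability_cst.
rewrite !big_nat_recr//= [leLHS]addeA addeAC.
apply: (@le_trans _ _ (\int[P]_x upcross_value a b n x + c n +
   \sum_(0 <= i < n) \int[P]_x upcross_gain a b i x)).
  by rewrite leeD2r// integral_upcross_step.
by rewrite addeAC [leRHS]addeA leeD2r.
Qed.

(** The expected total gain is finite, so almost surely there are finitely many sales. After the
    last one, either [X] stays at or above [a], or it drops below [a] and the unit then held is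
    never sold, which keeps [X] at or below [b]. *)
Lemma ae_upcross : \sum_(0 <= i <oo) c i < +oo ->
  {ae P, forall x, a%:E <= limn_einf (X ^~ x) \/ limn_esup (X ^~ x) <= b%:E}.
Proof.
move=> cfin.
have g0 n x : 0 <= upcross_gain a b n x by exact: upcross_gain_ge0.
have mg n : measurable_fun setT (upcross_gain a b n).
  exact: measurable_upcross_gain.
have gfin : P.-integrable setT (fun x => \sum_(0 <= i <oo) upcross_gain a b i x).
  apply/integrableP; split.
    by apply: ge0_emeasurable_sum => // n x _ _; exact: g0.
  under eq_integral => x _ do rewrite gee0_abs ?nneseries_ge0//.
  rewrite integral_nneseries//.
  apply: (@le_lt_trans _ _ (a%:E + \sum_(0 <= i <oo) c i)); last first.
    by rewrite lte_add_pinfty// ltry.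
  apply: lime_le.
    by apply: is_cvg_nneseries => n _ _; exact: integral_ge0.
  apply: nearW => n.
  apply: (@le_trans _ _ (a%:E + \sum_(0 <= i < n) c i)).
    apply: le_trans (upcross_gain_sum_le n); rewrite leeDr//.
    by apply: integral_ge0 => x _; exact: upcross_value_ge0.
  by rewrite leeD2l//; apply: nneseries_lim_ge.
apply: filterS (integrable_ae measurableT gfin) => x /(_ I) gx.
(* A gain is [0] or [b - a], so a series tail below [b - a] rules out further sales. *)
have [N gN] : exists N, forall n, (N <= n)%N -> upcross_gain a b n x = 0.
  have gx' : \sum_(0 <= k <oo) upcross_gain a b k x < +oo by rewrite ltey_eq gx.
  have ba : 0 < (b - a)%:E by rewrite lte_fin subr_gt0.
  have /= := nneseries_tail_cvg gx' (fun k _ => g0 k x).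
  move=> /cvg_limn_einf_sup[_ tail0].
  have [N _ NP] := limn_esup_lt_near (eq_ind_r (fun z => z < _) ba tail0).
  exists N => n Nn; rewrite /upcross_gain; case: ifP => // sell; exfalso.
  have := NP n Nn; rewrite /= ltNge => /negP; apply.
  apply: le_trans (nneseries_lim_ge n.+1 _) => //.
  by rewrite big_nat1 /upcross_gain sell.
have [[n Nn Xa]|low] := pselect (exists2 n, (N < n)%N & X n x < a%:E); last first.
  left; apply: le_limn_einf_near; exists N.+1 => // n /= Nn.
  by rewrite leNgt; apply/negP => Xa; apply: low; exists n.
right; apply: limn_esup_le_near.
(* At time [n] the unit is either kept, as [X n x < a < b], or bought. Here [N < n] makes [n]
   positive, as nothing is held at time [0]. *)
have hold k : upcross_hold a b (n + k)%N x.
  elim: k => [|k IH].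
    rewrite addn0; case: n Nn Xa => // n Nn Xa /=; case: ifP => // _.
    by apply/ltW/(lt_trans Xa); rewrite lte_fin.
  rewrite addnS /= IH leNgt; apply/negP => Xb.
  have := gN (n + k)%N (leq_trans (ltnW Nn) (leq_addr _ _)).
  rewrite /upcross_gain IH Xb /= => -[] /eqP.
  by rewrite subr_eq0 gt_eqF.
(* The bound [b] is read off from holding at two consecutive times, hence the start at [n.+1]. *)
exists n.+1 => // k /= nk.
have := hold (k - n)%N; rewrite subnKC ?(ltnW nk)//.
case: k nk => // k nk /=.
by have := hold (k - n)%N; rewrite subnKC// => ->.
Qed.

End Upcrossing.

(** A gap between the two limits would contain rationals [p < q] violating [ae_upcross]. The pairs
    are countable, so one null set serves them all; [p] is nonnegative because the lower limit
    is. *)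
Lemma ae_limn_esup_le_einf : \sum_(0 <= i <oo) c i < +oo ->
  {ae P, forall x, limn_esup (X ^~ x) <= limn_einf (X ^~ x)}.
Proof.
move=> cfin.
pose good (k : nat) x :=
  if @unpickle (rat * rat)%type k is Some (p, q) then
    (0 <= ratr p :> R)%R -> (ratr p < ratr q :> R)%R ->
    (ratr p)%:E <= limn_einf (X ^~ x) \/ limn_esup (X ^~ x) <= (ratr q)%:E
  else True.
have : {ae P, forall x k, good k x}.
  apply: ae_foralln => k; rewrite /good; case: unpickle => [[p q]|]; last first.
    exact: aeW.
  have [p0|p0] := pselect (0 <= ratr p :> R)%R; last exact: aeW.
  have [pq|pq] := pselect (ratr p < ratr q :> R)%R; last exact: aeW.
  by apply: filterS (ae_upcross p0 pq cfin).
apply: filterS => x; rewrite /good => gx; rewrite leNgt; apply/negP => infsup.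
have inf0 : 0 <= limn_einf (X ^~ x).
  by apply: le_limn_einf_near; exact: nearW.
have : limn_einf (X ^~ x) \is a fin_num.
  by rewrite ge0_fin_numE// (lt_le_trans infsup)// leey.
move: (limn_einf _) inf0 infsup gx => [l| |]// l0 lsup gx _.
(* The upper limit may be infinite, so a real [u] is interposed before choosing rationals. *)
have [u lu usup] : exists2 u : R, (l < u)%R & u%:E <= limn_esup (X ^~ x).
  move: (limn_esup _) lsup => [s| |]//= ls; first by exists s.
  by exists (l + 1)%R; rewrite ?ltrDl ?leey.
have [q /[!in_itv]/= /andP[lq qu]] := rat_in_itvoo lu.
have [p /[!in_itv]/= /andP[lp pq]] := rat_in_itvoo lq.
have := gx (pickle (p, q)); rewrite pickleK => /(_ _ pq)[].
- by apply: ltW; apply: le_lt_trans lp; rewrite -lee_fin.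
- by rewrite lee_fin leNgt lp.
- by move=> /(le_trans usup); rewrite lee_fin leNgt qu.
Qed.

Lemma near_supermartingale_integral_limn_esup :
  \int[P]_x limn_esup (X ^~ x) <= \int[P]_x X 0%N x + \sum_(0 <= i <oo) c i.
Proof.
have [cfin|] := ltP (\sum_(0 <= i <oo) c i) +oo; last first.
  rewrite leye_eq => /eqP ->; rewrite addey ?leey// -ltNye.
  by apply: (@lt_le_trans _ _ 0); [exact: ltNy0|exact: integral_ge0].
have inf0 x : 0 <= limn_einf (X ^~ x).
  by apply: le_limn_einf_near; exact: nearW.
have sup0 x : 0 <= limn_esup (X ^~ x) := le_trans (inf0 x) (limn_einf_sup _).
have msup : measurable_fun setT (fun x => limn_esup (X ^~ x)).
  exact: measurable_fun_limn_esup.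
have minf : measurable_fun setT (fun x => limn_einf (X ^~ x)).
  rewrite /limn_einf; apply: measurableT_comp => //.
  by apply: measurable_fun_limn_esup => n; exact: measurableT_comp.
(* Fatou's lemma controls only the lower limit, so the upper one is exchanged for it first. *)
apply: (@le_trans _ _ (\int[P]_x limn_einf (X ^~ x))).
  apply: ae_ge0_le_integral => //.
  by apply: filterS (ae_limn_esup_le_einf cfin).
apply: le_trans (fatou _ _ _ _) _ => //.
apply: le_trans (limn_einf_sup _) _.
apply: limn_esup_le_near; apply: nearW => n.
apply: le_trans (near_supermartingale_integral_le n) _.
by rewrite leeD2l//; exact: nneseries_lim_ge.
Qed.

End Theory.

(** * Stopping *)

Section StoppedProcess.
Variables (X : nat -> T -> \bar R) (tau : T -> option nat).

(** This is [X] at time [min tau n]; the recursive form yields adaptedness by induction. *)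
Fixpoint stopped_process (n : nat) (x : T) : \bar R :=
  if n is k.+1 then
    if enat_le (tau x) (Some k) then stopped_process k x else X n x
  else X 0%N x.

Lemma stopped_process_before n x :
  ~~ enat_le (tau x) (Some n) -> stopped_process n x = X n x.
Proof.
case: n => // n taun /=; case: ifP => //.
case: (tau x) taun => //= k; rewrite -ltnNge => /ltnW.
by rewrite leqNgt ltnS => /negbTE ->.
Qed.

Lemma stopped_process_after n k x :
  tau x = Some n -> (n <= k)%N -> stopped_process k x = X n x.
Proof.
move=> taux; elim: k => [|k IH]; first by rewrite leqn0 => /eqP ->.
by rewrite /= taux /= leq_eqVlt ltnS; case: leqP => [/IH//|_] /orP[/eqP ->|].
Qed.

(** Increments vanish once stopped, so the drift of [X] matters only on past events where [tau]
    exceeds [n]. *)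
Lemma near_supermartingale_stopped (c : nat -> \bar R) :
  (forall n, Gmeasurable (F n) (X n)) -> (forall n x, 0 <= X n x) ->
  stopping_time F tau ->
  (forall n A, F n A -> A `<=` [set x | ~~ enat_le (tau x) (Some n)] ->
     \int[P]_(x in A) X n.+1 x <= \int[P]_(x in A) X n x + c n) ->
  near_supermartingale stopped_process c.
Proof.
move=> GX X0 Ftau Xc.
have GY n : Gmeasurable (F n) (stopped_process n).
  elim: n => [|n IH] //=; apply: Gmeasurable_if => //.
    by apply: leF; exact: Ftau.
  by move=> B mB; apply/leF/IH.
have Y0 n x : 0 <= stopped_process n x by elim: n => //= n IH; case: ifP.
have mY n : measurable_fun setT (stopped_process n).
  exact: (Gmeasurable_measurable_fun (sF n)).
split=> // n A FA.
pose S := [set x | enat_le (tau x) (Some n)].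
have mS : measurable S by apply: (sub_sigma_measurable (sF n)); exact: Ftau.
have mA := sub_sigma_measurable (sF n) FA.
rewrite (ge0_integral_setIC _ mA mS)// [in leRHS](ge0_integral_setIC _ mA mS)//.
rewrite -addeA; apply: leeD.
  rewrite (eq_integral (stopped_process n))// => x.
  by rewrite inE /S /= => -[_ ->].
rewrite (eq_integral (X n.+1)); last first.
  by move=> x; rewrite inE /S /= => -[_ /negP/negbTE ->].
rewrite [X in _ <= X + _](eq_integral (X n)); last first.
  by move=> x; rewrite inE => -[_ /negP]; exact: stopped_process_before.
apply: Xc; last by move=> x [_ /negP].
by apply: sub_sigmaI => //; apply: sub_sigmaC => //; exact: Ftau.
Qed.

End StoppedProcess.

End NearSupermartingale.

(** The stopped process is eventually constant where [tau] is finite and equals [E m] elsewhere, so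
    one upper limit covers both cases. *)
Lemma stoppedE {d : measure_display} {T : measurableType d} {R : realType}
    (E : nat -> nat -> T -> \bar R) m tau x :
  stopped E m tau x = limn_esup (fun n => stopped_process (E m) tau n x).
Proof.
rewrite /stopped; case taux: (tau x) => [n|].
  rewrite (cvg_limn_einf_sup (l := E m n x) _).2//.
  apply: cvg_near_cst; exists n => // k /= nk.
  exact: stopped_process_after.
congr limn_esup; apply/funext => n.
by rewrite stopped_process_before// taux.
Qed.

(** Zeroing the terms from [r] on treats finite and infinite horizons alike. *)
Lemma esum_uptoE {R : realType} (r : option nat) (f : nat -> \bar R) :
  esum_upto r f = \sum_(0 <= n <oo) (if enat_le r (Some n) then 0 else f n).
Proof.
case: r => [k|] //=; apply/esym; apply: lim_near_cst => //.
exists k => // n /= kn; rewrite (big_cat_nat _ kn)//=.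
rewrite [X in _ + X]big_nat_cond [X in _ + X]big1 ?adde0; last first.
  by move=> i /andP[/andP[-> _] _].
by apply: eq_big_nat => i /andP[_ ik]; rewrite leqNgt ik.
Qed.

(** * The bound for fixed [m] and [P] *)

Section StoppedBound.
Context {d : measure_display} {T : measurableType d} {R : realType}.
Variables (P : probability T R) (F : nat -> nat -> set (set T)).
Variables (E : nat -> nat -> T -> \bar R).
Variables (C : probability T R -> nat -> nat -> T -> \bar R).
Hypothesis FA : filtration_array F.
Hypothesis GE : adapted F E.
Hypothesis E0 : forall m n x, 0 <= E m n x.
Hypothesis CP : forall m n, P.-integrable setT (E m n.+1) ->
  is_cond_exp P (F m n) (E m n.+1) (C P m n).

Let sF m n : sub_sigma (F m n). Proof. by case: FA. Qed.

Let leF m n : F m n `<=` F m n.+1.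
Proof. by move=> A; case: FA => _ /[apply] -[]. Qed.

Let mE m n : measurable_fun setT (E m n).
Proof. exact: (Gmeasurable_measurable_fun (sF m n)). Qed.

Lemma posp_ge0 (v : \bar R) : 0 <= posp v.
Proof. by rewrite /posp le_max lexx orbT. Qed.

Lemma measurable_posp_delta m n :
  measurable_fun setT (fun x => posp (delta E C P m n x)).
Proof.
rewrite /posp; apply: measurable_maxe => //; rewrite /delta.
case: asboolP => // /CP[GC _]; apply: emeasurable_funB => //.
exact: (Gmeasurable_measurable_fun (sF m n)).
Qed.

Lemma integral_le_posp_delta m n A : F m n A ->
  \int[P]_(x in A) E m n.+1 x <=
  \int[P]_(x in A) E m n x + \int[P]_x posp (delta E C P m n x).
Proof.
move=> FmnA; have mA := sub_sigma_measurable (sF m n) FmnA.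
(* Without integrability [delta] is [+oo] by convention and the right side is infinite. *)
have [iE|niE] := pselect (P.-integrable setT (E m n.+1)); last first.
  have -> : \int[P]_x posp (delta E C P m n x) = +oo.
    rewrite -[RHS](integral_probability_cst P); apply: eq_integral => x _.
    by rewrite /delta asboolF// /posp; apply/max_idPl; rewrite leey.
  rewrite addey ?leey// -ltNye.
  by apply: (@lt_le_trans _ _ 0); [exact: ltNy0|exact: integral_ge0].
have [GC [_ <-//]] := CP iE.
have mC := Gmeasurable_measurable_fun (sF m n) GC.
have mD := measurable_posp_delta m n.
apply: (@le_trans _ _ (\int[P]_(x in A) (E m n x + posp (delta E C P m n x)))).
  (* The version [C] may be negative at some points; its positive part allows monotonicity for
     nonnegative integrands. *)
  apply: (@le_trans _ _ (\int[P]_(x in A) posp (C P m n x))).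
    rewrite [leLHS]integralE -[leRHS]adde0; apply: leeD.
      by under eq_integral => x _ do rewrite funeposE.
    by rewrite oppe_le0; exact: integral_ge0.
  apply: ge0_le_integral => //.
  - by move=> x _; exact: posp_ge0.
  - by apply: measurable_funTS; exact: measurable_maxe.
  - by apply: emeasurable_funD; exact: measurable_funTS.
  - move=> x _; rewrite /posp ge_max adde_ge0 ?posp_ge0// andbT.
    rewrite /delta asboolT//.
    move: (E0 m n x); case: (E m n x) => [e| |]// e0; last first.
      by rewrite addye ?leey// -ltNye (lt_le_trans _ (posp_ge0 _)) ?ltNy0.
    by rewrite -leeBlDl// le_max lexx.
rewrite ge0_integralD//;
  [|exact: measurable_funTS|by move=> x _; exact: posp_ge0
   |exact: measurable_funTS].
rewrite leeD2l//; apply: ge0_subset_integral => //.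
by move=> x _; exact: posp_ge0.
Qed.

Lemma integral_stopped_le m (r : option nat) (tau : T -> option nat) :
  stopping_time (F m) tau -> P [set x | enat_le (tau x) r] = 1 ->
  \int[P]_x stopped E m tau x <= \int[P]_x E m 0%N x +
    \int[P]_x esum_upto r (fun n => posp (delta E C P m n x)).
Proof.
move=> Ftau taur.
under eq_integral => x _ do rewrite stoppedE.
pose c n := \int[P]_x
  (if enat_le r (Some n) then 0 else posp (delta E C P m n x)).
have -> : \int[P]_x esum_upto r (fun n => posp (delta E C P m n x)) =
    \sum_(0 <= n <oo) c n.
  rewrite -integral_nneseries//.
  - by apply: eq_integral => x _; exact: esum_uptoE.
  - by move=> n; case: (enat_le _ _) => //; exact: measurable_posp_delta.
  - by move=> n x _; case: (enat_le _ _) => //; exact: posp_ge0.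
apply: (near_supermartingale_integral_limn_esup (P := P) (sF m) (@leF m)
  (X := stopped_process (E m) tau) (c := c)); last first.
  move=> n; apply: integral_ge0 => x _.
  by case: (enat_le _ _) => //; exact: posp_ge0.
apply: (near_supermartingale_stopped (sF m) (@leF m)) => //.
move=> n A FmnA taun; rewrite /c.
(* From the horizon on, [c n] is [0]; there [A] lies in the null event where [tau] exceeds [r], so
   the left integral vanishes. *)
case rn: (enat_le r (Some n)); last exact: integral_le_posp_delta.
have mA := sub_sigma_measurable (sF m n) FmnA.
rewrite [leLHS]null_set_integral//; first by rewrite adde_ge0// integral_ge0.
  exact: measurable_funTS.
case: r @c taur rn => [k|]// _ tauk kn.
have mS : measurable [set x | enat_le (tau x) (Some k)].
  exact: (sub_sigma_measurable (sF m k) (Ftau k)).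
apply: (@subset_measure0 _ _ _ P A (~` [set x | enat_le (tau x) (Some k)])) => //.
- exact: measurableC.
- move=> x /taun /= /negP taunx taukx; apply: taunx.
  by case: (tau x) taukx => //= j /leq_trans; apply.
- by apply: (etrans (probability_setC _ mS)); rewrite tauk subee.
Qed.

End StoppedBound.

(** * Suprema over the set of measures *)

Section SupP.
Context {d : measure_display} {T : measurableType d} {R : realType}.
Variable Pset : set (probability T R).
Implicit Types f g h : probability T R -> \bar R.

Lemma supP_ge0 f : 0 <= supP Pset f.
Proof. by apply: ereal_sup_ubound; left. Qed.

Lemma supP_le_add f g h : (forall P, Pset P -> f P <= g P + h P) ->
  supP Pset f <= supP Pset g + supP Pset h.
Proof.
(* The value [0] adjoined by [supP] is a separate competitor, settled by nonnegativity. *)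
move=> fgh; apply: ge_ereal_sup => _ [->|[P PP <-]].
  by rewrite adde_ge0// supP_ge0.
apply: le_trans (fgh P PP) _.
by apply: leeD; apply: ereal_sup_ubound; right; exists P.
Qed.

End SupP.

Theorem mainTheorem7 (d : measure_display) (T : measurableType d) (R : realType)
  (Pset : set (probability T R))
  (F : nat -> nat -> set (set T))
  (E : nat -> nat -> T -> \bar R)
  (C : probability T R -> nat -> nat -> T -> \bar R)
  (r : nat -> option nat) :
  filtration_array F ->
  adapted F E ->
  (forall m n x, 0 <= E m n x) ->
  (* C P m n is a version of E_P[E_{m,n+1} | F_{m,n}] whenever E_{m,n+1} is P-integrable *)
  (forall P, Pset P -> forall m n, P.-integrable setT (E m n.+1) ->
     is_cond_exp P (F m n) (E m n.+1) (C P m n)) ->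
  (* asymptotic supermartingale property *)
  (forall n, (fun m => supP Pset (fun P => \int[P]_x posp (delta E C P m n x)))
               @ \oo --> 0) ->
  (* asymptotic calibration *)
  limn_esup (fun m => supP Pset (fun P => \int[P]_x E m 0%N x)) <= 1 ->
  (* condition on r *)
  (fun m => supP Pset (fun P =>
      \int[P]_x esum_upto (r m) (fun n => posp (delta E C P m n x)))) @ \oo --> 0 ->
  (* conclusion: E is an r-asymptotic e-process *)
  forall tau : nat -> T -> option nat,
    (forall m, stopping_times_bdd (r m) (F m) Pset (tau m)) ->
    limn_esup (fun m => supP Pset (fun P => \int[P]_x stopped E m (tau m) x)) <= 1.
Proof.
move=> FA GE E0 CP _ E1 rD tau tauP.
apply: (limn_esup_le_add_cvg0 _ E1 rD) => m; apply: supP_le_add => P PP.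
have [Ftau taur] := tauP m.
exact: (integral_stopped_le FA GE E0 (CP P PP) Ftau (taur P PP)).
Qed.
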